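(* Let $(X,f,x_0)$ be a minimal counting system with $X$ finite, and let $z$ be the end-point of $(X,f,x_0)$. (1) If $f(z) = x_0$ then $f$ is bijective. In this case $x_0 \in f(X)$. (2) If $f(z) \ne x_0$ then $f$ is not injective and $x_0 \notin f(X)$.
   Context: For a set $A$ let $\mathcal{P}(A)$ denote its power set. A subset $\mathcal{K} \subset \mathcal{P}(A)$ is an inductive system in $\mathcal{P}(A)$ if $\varnothing \in \mathcal{K}$ and $B \cup \{a\} \in \mathcal{K}$ for all $B \in \mathcal{K}$ and $a \in A \setminus B$. A set $A$ is finite if $\mathcal{P}(A)$ itself is the only inductive system in $\mathcal{P}(A)$. A counting system is a triple $(X,f,x_0)$ with $X$ a set, $f : X \to X$ a mapping and $x_0 \in X$. It is minimal if the only subset $Y \subset X$ with $f(Y) \subset Y$ and $x_0 \in Y$ is $X$ itself. For $z \in X$, it is $z$-minimal if the only subset $X'$ of $X$ which contains $x_0$ and satisfies $f(X' \setminus \{z\}) \subset X'$ is $X$ itself. If $(X,f,x_0)$ is minimal and $X$ is finite, there exists a unique $z \in X$ such that $(X,f,x_0)$ is $z$-minimal; this $z$ is called the end-point of $(X,f,x_0)$. *)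

(* Defs.v *)
From mathcomp Require Import all_boot.
From mathcomp Require Import boolp classical_sets.

Set Implicit Arguments.
Unset Strict Implicit.
Unset Printing Implicit Defensive.

Local Open Scope classical_set_scope.

(* An ambient set is rendered as a type A, and its power set as [set A]. *)

Definition inductive_system (A : Type) (K : set (set A)) : Prop :=
  K set0 /\ forall (B : set A) (a : A), K B -> (~` B) a -> K (B `|` [set a]).

(* This notion of finiteness does not mention natural numbers, unlike
   [finite_set] of mathcomp-classical. *)
Definition is_finite (A : Type) : Prop :=
  forall K : set (set A), inductive_system K -> K = setT.

(* A counting system is a type X with a map f : X -> X and a point x0 : X. *)
Definition minimal (X : Type) (f : X -> X) (x0 : X) : Prop :=
  forall Y : set X, f @` Y `<=` Y -> Y x0 -> Y = setT.

Definition z_minimal (X : Type) (f : X -> X) (x0 z : X) : Prop :=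
  forall X' : set X, X' x0 -> f @` (X' `\ z) `<=` X' -> X' = setT.

(* For a minimal counting system on a finite X there is exactly one such z. *)
Definition is_end_point (X : Type) (f : X -> X) (x0 z : X) : Prop :=
  z_minimal f x0 z.

(* Main.v *)
(** If [x0] lies in the range of [f], the range is [f]-invariant and contains
    [x0], so [f] is onto by minimality, hence bijective as [X] is finite.  If
    [f z <> x0] then [f] cannot be injective: otherwise the complement of
    [{f z}] would contain [x0] and be closed under [f] away from [z]. *)

Require Import Defs.
From mathcomp Require Import all_boot.
From mathcomp Require Import boolp classical_sets.

Set Implicit Arguments.
Unset Strict Implicit.
Unset Printing Implicit Defensive.

Local Open Scope classical_set_scope.

(** The sets covered by some list form an inductive system, so the full set is one of them.
    [{classic X}] supplies the decidable equality that [\in] and [uniq] require. *)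
Lemma is_finite_enum (X : Type) :
  is_finite X -> exists s : seq {classic X}, uniq s /\ forall x, x \in s.
Proof.
move=> X_fin.
pose K : set (set X) :=
  [set B | exists s : seq {classic X}, forall x, B x -> x \in s].
have K_ind : inductive_system K.
  split; first by exists [::].
  move=> B a [s sB] _; exists (a :: s) => x [Bx|->]; rewrite inE ?eqxx//.
  by rewrite sB ?orbT.
have [s sT] : K setT by rewrite (X_fin K K_ind).
by exists (undup s); split=> [|x]; rewrite ?undup_uniq// mem_undup sT.
Qed.

Lemma finite_surjective_bijective (X : Type) (f : X -> X) :
  is_finite X -> range f = setT -> bijective f.
Proof.
move=> /is_finite_enum[s [s_uniq sT]] f_surj.
have /choice[g gK] : forall y, exists x, f x = y.
  by move=> y; have [x _ <-] : range f y; [rewrite f_surj | exists x].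
exists g => // x.
(* The section [g] is injective, so [gs] is duplicate-free and as long as [s], hence exhausts [X].
   Thus [g] is onto, and a surjective section is a two-sided inverse. *)
pose gs := map (g : {classic X} -> {classic X}) s.
have gs_uniq : uniq gs by rewrite map_inj_uniq //; exact: can_inj gK.
have [||_ gsE] := uniq_min_size gs_uniq (s2 := s).
- by move=> y _; exact: sT.
- by rewrite size_map.
have /mapP[y _ ->] : (x : {classic X}) \in gs by rewrite gsE.
by rewrite gK.
Qed.

Lemma minimal_range (X : Type) (f : X -> X) (x0 : X) :
  minimal f x0 -> range f x0 -> range f = setT.
Proof. by move=> f_min; apply: f_min => _ [x _ <-]; exists x. Qed.

Lemma z_minimal_injective (X : Type) (f : X -> X) (x0 z : X) :
  z_minimal f x0 z -> injective f -> f z = x0.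
Proof.
move=> z_min f_inj; apply: contrapT => fz_neq.
have : (~` [set f z]) (f z); last exact.
rewrite (z_min (~` [set f z])) //; first by move=> /esym.
by move=> _ [x [_ xz] <-] /f_inj.
Qed.

Theorem proposition4p1 (X : Type) (f : X -> X) (x0 z : X)
    (f_min : minimal f x0) (X_fin : is_finite X)
    (z_end : is_end_point f x0 z) :
  (f z = x0 -> bijective f /\ range f x0) /\
  (f z <> x0 -> ~ injective f /\ ~ range f x0).
Proof.
have bij : range f x0 -> bijective f.
  by move=> /(minimal_range f_min); exact: finite_surjective_bijective.
split=> [fz|fz_neq].
  have x0_range : range f x0 by exists z.
  by split; first exact: bij.
have f_ninj : ~ injective f by move=> /(z_minimal_injective z_end).
(* If [x0] were in the range, [f] would be bijective, against non-injectivity. *)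
by split=> // /bij /bij_inj.
Qed.
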